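(* Let $n\geq 0$ be an integer. Then: (1) $\overline{p}(4n)\equiv(-1)^n\,\overline{p}(n)\pmod{16}$. (2) If $n$ is not the square of an odd positive integer, then $\overline{p}(4n)\equiv(-1)^n\,\overline{p}(n)\pmod{32}$. (3) If $n\not\equiv 1,2,5\pmod{8}$, then $\overline{p}(4n)\equiv(-1)^n\,\overline{p}(n)\pmod{64}$. (4) If $n\equiv 0\pmod{4}$, then $\overline{p}(4n)\equiv(-1)^n\,\overline{p}(n)\pmod{128}$.
   Context: An overpartition of a nonnegative integer $n$ is a partition of $n$ in which the first occurrence of each distinct part may be overlined. $\overline{p}(n)$ denotes the number of overpartitions of $n$ (with $\overline{p}(0)=1$); for example $\overline{p}(3)=8$. Its generating function is $\sum_{n\ge 0}\overline{p}(n)q^n=\prod_{m\ge 1}\frac{1+q^m}{1-q^m}$. *)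

(* Defs.v *)
From mathcomp Require Import all_boot all_order all_algebra.

Set Implicit Arguments.
Unset Strict Implicit.
Unset Printing Implicit Defensive.

(* A pair (a, b) is a part a, overlined when b is true; parts are listed in
   weakly decreasing order. [index a (unzip1 s)] is the position of the first
   occurrence of the part a. *)
Definition is_overpartition (n : nat) (s : seq (nat * bool)) : bool :=
  [&& sorted geq (unzip1 s), 0 \notin unzip1 s, sumn (unzip1 s) == n
    & all (fun i => nth false (unzip2 s) i ==>
                    (index (nth 0 (unzip1 s) i) (unzip1 s) == i))
          (iota 0 (size s))].

(* An overpartition of n has at most n parts, each at most n, so all of them
   are found among the bounded sequences below (see pbar_enum). *)
Definition pbar (n : nat) : nat :=
  #|[set s : {bseq n of 'I_n.+1 * bool} |
      is_overpartition n [seq (val x.1, x.2) | x <- s]]|.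

Lemma is_overpartition_bound n s : is_overpartition n s ->
  size s <= n /\ (forall x, x \in s -> x.1 <= n).
Proof.
case/and4P=> _ s0 /eqP <- _; elim: s s0 => [|[a b] s IHs] //=.
rewrite inE negb_or eq_sym -lt0n => /andP[a0 /IHs[le_s le_x]]; split.
  by rewrite -add1n leq_add.
move=> x; rewrite inE => /predU1P[-> | /le_x le_xs]; first exact: leq_addr.
exact: leq_trans le_xs (leq_addl _ _).
Qed.

Lemma pbar_enum n (l : seq (seq (nat * bool))) :
  uniq l -> (forall s, (s \in l) = is_overpartition n s) -> pbar n = size l.
Proof.
move=> Ul def_l; rewrite /pbar.
set A := [set _ | _].
pose f (s : {bseq n of 'I_n.+1 * bool}) : seq (nat * bool) :=
  [seq (val x.1, x.2) | x <- s].
have f_inj : injective f.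
  move=> s t eq_f; apply/val_inj; apply: inj_map eq_f => -[a b] [c d] /=.
  by case=> /val_inj-> ->.
rewrite cardE -(size_map f); apply/perm_size/uniq_perm => //.
  by rewrite (map_inj_uniq f_inj) enum_uniq.
move=> s; rewrite def_l; apply/mapP/idP => [[t] | ov_s].
  by rewrite mem_enum inE => ov_t ->.
have [le_s le_x] := is_overpartition_bound ov_s.
pose u : seq ('I_n.+1 * bool) := [seq (inord x.1, x.2) | x <- s].
have le_u : size u <= n by rewrite size_map.
have fu : f (Bseq le_u) = s.
  rewrite /f /= -map_comp -[RHS]map_id; apply/eq_in_map => -[a b] /le_x /= le_a.
  by rewrite inordK.
by exists (Bseq le_u); rewrite ?fu // mem_enum inE -/(f _) fu.
Qed.

(* Main.v *)
Require Import Defs.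
From mathcomp Require Import all_boot all_order all_algebra.
From HB Require Import structures.
From mathcomp Require Import boolp ring zify.
Import GRing.Theory.

(** Let phi(q) be the sum of q^(k^2) over all integers k, let P(q) be the
    generating function of pbar, and let psi(q) be the sum of the q^(k(k+1)/2)
    over k >= 0. The proof is a computation with these power series.

    Gauss's identity [twist_phiP] says that P(q) = 1/phi(-q); hence
    P(-q) = 1/phi(q) generates (-1)^n pbar(n). Separating even and odd squares
    gives phi(q) = a + 2b and phi(-q) = a - 2b [phi_split, twist_phi], where
    a = phi(q^4), whose exponents are multiples of 4, and b = q psi(q^8) is the
    sum of q^(k^2) over odd k > 0, whose exponents are 1 modulo 8.

    Replacing q by -q in the product of the (1 + q^m)/(1 - q^m) exchanges
    numerators and denominators at odd m, so P(q)P(-q) = P(q^2)^2 [P_twist].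
    Applied twice, this yields
      P(q) = phi(q) phi(q^2)^2 P(q^4)^4 = (a + 2b)(a^2 + 4b^2) P(q^4)^4,
    where phi(q^2)^2 = a^2 + 4b^2 is that relation for phi [dilate2_phi_sqr]. In
    the expansion of (a + 2b)(a^2 + 4b^2) only a^3 has exponents divisible by 4,
    so pbar(4n) is the coefficient of q^n in phi(q)^3 P(q)^4 [P_4muln].

    Therefore the generating function of pbar(4n) - (-1)^n pbar(n) is
      (phi(q)^4 - phi(-q)^4) / (phi(q) phi(-q)^4)
        = 16 a b (a^2 + 4b^2) / ((a + 2b)(a - 2b)^4).
    Modulo 8, a^2 + 4b^2 may be replaced by a^2 - 4b^2, and (a - 2b)^4 = 1, since
    a - 2b is 1 modulo 2. What remains is 16 (a^2 b - 2 a b^2) modulo 128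
    [theta_quotient_mod128]; as a is 1 modulo 2, it is 16 (b - 2 b^2) modulo 64.
    The four claims are read off from the exponents that occur in a and b. *)

Set Implicit Arguments.
Unset Strict Implicit.
Unset Printing Implicit Defensive.

Local Open Scope ring_scope.

(** * Formal power series *)

(** A record rather than a bare function type, so that the product below does
    not compete with the pointwise product of functions. *)
Record series (R : Type) := Series {coef_series :> nat -> R}.

HB.instance Definition _ (R : Type) := gen_eqMixin (series R).
HB.instance Definition _ (R : Type) := gen_choiceMixin (series R).

Lemma seriesP (R : Type) (f g : series R) : (forall n, f n = g n) -> f = g.
Proof. by case: f g => f [g] /= /funext->. Qed.

Section SeriesRing.
Variable R : comNzRingType.
Implicit Types (f g h : series R) (p : {poly R}).

Definition series0 : series R := Series (fun=> 0).
Definition series1 : series R := Series (fun n => (n == 0%N)%:R).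
Definition series_opp f : series R := Series (fun n => - f n).
Definition series_add f g : series R := Series (fun n => f n + g n).
Definition series_mul f g : series R :=
  Series (fun n => \sum_(i < n.+1) f i * g (n - i)%N).

Fact series_addA : associative series_add.
Proof. by move=> f g h; apply: seriesP => n /=; rewrite addrA. Qed.
Fact series_addC : commutative series_add.
Proof. by move=> f g; apply: seriesP => n /=; rewrite addrC. Qed.
Fact series_add0 : left_id series0 series_add.
Proof. by move=> f; apply: seriesP => n /=; rewrite add0r. Qed.
Fact series_addN : left_inverse series0 series_opp series_add.
Proof. by move=> f; apply: seriesP => n /=; rewrite addNr. Qed.

HB.instance Definition _ := GRing.isZmodule.Build (series R)
  series_addA series_addC series_add0 series_addN.

(** Coefficients up to n of a product depend only on coefficients up to n, so the
    ring laws of series are inherited from those of polynomials. *)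
Definition approx n p f := forall i, (i <= n)%N -> p`_i = f i.

Lemma approx_poly n f : approx n (\poly_(i < n.+1) f i) f.
Proof. by move=> i le_in; rewrite coef_poly ltnS le_in. Qed.

Lemma approx_mul n p q f g :
  approx n p f -> approx n q g -> approx n (p * q) (series_mul f g).
Proof.
move=> pf qg i le_in; rewrite coefM; apply: eq_bigr => j _.
by rewrite pf ?qg //; have := ltn_ord j; lia.
Qed.

Fact series_mulA : associative series_mul.
Proof.
move=> f g h; apply: seriesP => n.
have pf := @approx_poly n f; have qg := @approx_poly n g.
have rh := @approx_poly n h.
rewrite -(approx_mul pf (approx_mul qg rh)) //.
by rewrite -(approx_mul (approx_mul pf qg) rh) // mulrA.
Qed.

Fact series_mulC : commutative series_mul.
Proof.
move=> f g; apply: seriesP => n.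
have pf := @approx_poly n f; have qg := @approx_poly n g.
by rewrite -(approx_mul pf qg) // mulrC (approx_mul qg pf).
Qed.

Fact series_mul1 : left_id series1 series_mul.
Proof.
move=> f; apply: seriesP => n /=; rewrite big_ord_recl /= mul1r subn0.
by rewrite big1 ?addr0 // => i _; rewrite mul0r.
Qed.

Fact series_mulDl : left_distributive series_mul series_add.
Proof.
move=> f g h; apply: seriesP => n /=; rewrite -big_split.
by apply: eq_bigr => i _; rewrite mulrDl.
Qed.

Fact series_1neq0 : series1 != 0.
Proof.
by apply/eqP => /(congr1 (fun f : series R => f 0%N)) /eqP /=; rewrite oner_eq0.
Qed.

HB.instance Definition _ := GRing.Zmodule_isComNzRing.Build (series R)
  series_mulA series_mulC series_mul1 series_mulDl series_1neq0.

Lemma series0E n : (0 : series R) n = 0. Proof. by []. Qed.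
Lemma series1E n : (1 : series R) n = (n == 0%N)%:R. Proof. by []. Qed.
Lemma seriesDE f g n : (f + g) n = f n + g n. Proof. by []. Qed.
Lemma seriesNE f n : (- f) n = - f n. Proof. by []. Qed.
Lemma seriesME f g n : (f * g) n = \sum_(i < n.+1) f i * g (n - i)%N.
Proof. by []. Qed.
Lemma seriesMnE f k n : (f *+ k) n = f n *+ k.
Proof. by elim: k => [|k IHk]; rewrite ?mulr0n // !mulrS seriesDE IHk. Qed.

Definition seriesE := (series0E, series1E, seriesDE, seriesNE, seriesMnE).

(** The monomial q^m. *)
Definition Xn m : series R := Series (fun n => (n == m)%:R).

Lemma seriesXnM m f n : (Xn m * f) n = if (m <= n)%N then f (n - m)%N else 0.
Proof.
rewrite seriesME; case: ifP => [le_mn | /negbT gt_mn].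
  rewrite -ltnS in le_mn; rewrite (bigD1 (Ordinal le_mn)) //= eqxx mul1r.
  by rewrite big1 ?addr0 // => i /negPf; rewrite -val_eqE /= => ->; rewrite mul0r.
rewrite big1 // => i _ /=; case: eqP => [eq_im | _]; last by rewrite mul0r.
by have := ltn_ord i; rewrite eq_im ltnS (negPf gt_mn).
Qed.

Lemma XnD m n : Xn (m + n)%N = Xn m * Xn n.
Proof.
apply: seriesP => i; rewrite seriesXnM /=; case: ifP => le_mi.
  by congr _%:R; lia.
by case: eqP => // Di; lia.
Qed.

(** The substitution of q^m for q, a ring morphism when m > 0. *)
Definition dilate m f : series R :=
  Series (fun n => if (m %| n)%N then f (n %/ m)%N else 0).

Lemma dilate_is_zmod_morphism m : zmod_morphism (dilate m).
Proof. by move=> f g; apply: seriesP => n /=; case: ifP; rewrite ?subr0. Qed.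

HB.instance Definition _ m :=
  GRing.isZmodMorphism.Build (series R) (series R) (dilate m)
    (dilate_is_zmod_morphism m).

Lemma approx_dilate m n p f :
  approx n p f -> approx n (p \Po 'X^(m.+1)) (dilate m.+1 f).
Proof.
move=> pf i le_in; rewrite coef_comp_poly_Xn //=; case: ifP => // _.
by apply: pf; apply: leq_trans (leq_div _ _) le_in.
Qed.

Lemma dilate_is_monoid_morphism m : monoid_morphism (dilate m.+1).
Proof.
split=> [|f g]; apply: seriesP => n.
  case: n => [|n] /=; rewrite ?dvdn0 ?div0n //; case: ifP => // /divnK.
  by case: (_ %/ _)%N.
have pf := @approx_poly n f; have qg := @approx_poly n g.
rewrite -(approx_dilate m (approx_mul pf qg)) // rmorphM /=.
by rewrite (approx_mul (approx_dilate m pf) (approx_dilate m qg)).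
Qed.

HB.instance Definition _ m :=
  GRing.isMonoidMorphism.Build (series R) (series R) (dilate m.+1)
    (dilate_is_monoid_morphism m).

Lemma dilateE m f n : dilate m f n = if (m %| n)%N then f (n %/ m)%N else 0.
Proof. by []. Qed.

Lemma dilate_muln m f n : dilate m.+1 f (m.+1 * n)%N = f n.
Proof. by rewrite /= dvdn_mulr // mulKn. Qed.

Lemma dilate_inj m : injective (dilate m.+1).
Proof.
by move=> f g eq_fg; apply: seriesP => n; rewrite -(dilate_muln m) eq_fg dilate_muln.
Qed.

Lemma dilate_dilate m n f : (0 < n)%N -> dilate m (dilate n f) = dilate (m * n)%N f.
Proof.
move=> n_gt0; case: m => [|m].
  by apply: seriesP => -[|i] /=; rewrite ?div0n ?dvdn0 ?dvd0n ?mul0n //= dvdn0 div0n.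
apply: seriesP => i; rewrite !dilateE; case: (boolP (m.+1 %| i)%N) => [/dvdnP[k ->]|nd].
  by rewrite mulnK // [(k * _)%N]mulnC dvdn_pmul2l // divnMl.
by case: ifP => // /(dvdn_trans (dvdn_mulr n (dvdnn _))); rewrite (negPf nd).
Qed.

Lemma dilate_Xn m n : dilate m.+1 (Xn n) = Xn (m.+1 * n)%N.
Proof.
apply: seriesP => i /=; case: ifP => [/dvdnP[k ->] | nd].
  by rewrite mulnK // mulnC eqn_pmul2l.
by case: eqP => // Di; rewrite Di dvdn_mulr in nd.
Qed.

(** The substitution of -q for q. *)
Definition twist f : series R := Series (fun n => (-1) ^+ n * f n).

Lemma twist_is_zmod_morphism : zmod_morphism twist.
Proof. by move=> f g; apply: seriesP => n /=; rewrite mulrBr. Qed.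

HB.instance Definition _ :=
  GRing.isZmodMorphism.Build (series R) (series R) twist twist_is_zmod_morphism.

Lemma twist_is_monoid_morphism : monoid_morphism twist.
Proof.
split=> [|f g]; apply: seriesP => n.
  by case: n => [|n] /=; rewrite ?mulr0 // mul1r.
rewrite /= mulr_sumr; apply: eq_bigr => i _.
by rewrite mulrACA -exprD subnKC // -ltnS.
Qed.

HB.instance Definition _ :=
  GRing.isMonoidMorphism.Build (series R) (series R) twist twist_is_monoid_morphism.

Lemma twistE f n : twist f n = (-1) ^+ n * f n. Proof. by []. Qed.

Lemma twistK : involutive twist.
Proof.
by move=> f; apply: seriesP => n; rewrite !twistE mulrA -expr2 sqrr_sign mul1r.
Qed.

Lemma twist_dilate m f : ~~ odd m -> twist (dilate m f) = dilate m f.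
Proof.
move=> ev_m; apply: seriesP => n; rewrite twistE /=; case: ifP; rewrite ?mulr0 //.
by case/dvdnP => k ->; rewrite -signr_odd oddM (negPf ev_m) andbF mul1r.
Qed.

Lemma twist_Xn m : twist (Xn m) = (-1) ^+ m * Xn m.
Proof.
rewrite -signr_odd mulr_sign; apply: seriesP => n; rewrite twistE.
have [->|nm] := eqVneq n m; first rewrite -signr_odd.
  by case: odd; rewrite ?seriesE ?mulN1r ?mul1r.
have Xn0 : Xn m n = 0 by rewrite /= (negPf nm).
by case: odd; rewrite ?seriesE Xn0 mulr0 ?oppr0.
Qed.

Definition eqmodX N f g := forall n, (n < N)%N -> f n = g n.

Lemma eqmodX_refl N f : eqmodX N f f. Proof. by []. Qed.
Lemma eqmodX_sym N f g : eqmodX N f g -> eqmodX N g f.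
Proof. by move=> fg n lt_nN; rewrite fg. Qed.
Lemma eqmodX_trans N f g h : eqmodX N f g -> eqmodX N g h -> eqmodX N f h.
Proof. by move=> fg gh n lt_nN; rewrite fg ?gh. Qed.
Lemma eqmodX_le M N f g : (M <= N)%N -> eqmodX N f g -> eqmodX M f g.
Proof. by move=> le_MN fg n /leq_trans lt_n; apply/fg/lt_n. Qed.
Lemma eqmodXD N f g h k :
  eqmodX N f g -> eqmodX N h k -> eqmodX N (f + h) (g + k).
Proof. by move=> fg hk n lt_nN; rewrite !seriesE fg ?hk. Qed.
Lemma eqmodXM N f g h k :
  eqmodX N f g -> eqmodX N h k -> eqmodX N (f * h) (g * k).
Proof.
move=> fg hk n lt_nN; apply: eq_bigr => i _; have lt_in := ltn_ord i.
by rewrite fg ?hk //; lia.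
Qed.
Lemma eqmodX_XnM N m f g : eqmodX (N - m) f g -> eqmodX N (Xn m * f) (Xn m * g).
Proof.
by move=> fg n lt_nN; rewrite !seriesXnM; case: ifP => // le_mn; apply: fg; lia.
Qed.
Lemma eqmodX_Xn0 N m f : (N <= m)%N -> eqmodX N (Xn m * f) 0.
Proof. by move=> le_Nm n lt_nN; rewrite seriesXnM ifN //; lia. Qed.
Lemma eqmodX_eq f g : (forall N, eqmodX N f g) -> f = g.
Proof. by move=> fg; apply: seriesP => n; apply: (fg n.+1). Qed.

(** The series of 1/(1 - q^m). *)
Definition geom m : series R := dilate m (Series (fun=> 1)).

Lemma geomK m : (1 - Xn m.+1) * geom m.+1 = 1.
Proof.
(* It suffices to multiply 1 - q by the sum of all q^n, and dilate. *)
have <- : dilate m.+1 (1 - Xn 1) = 1 - Xn m.+1.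
  by rewrite rmorphB rmorph1 /= dilate_Xn muln1.
rewrite -rmorphM -[RHS](rmorph1 (dilate m.+1)); congr dilate.
apply: seriesP => n; rewrite mulrBl mul1r !seriesE seriesXnM /=.
by case: n => [|n] /=; rewrite ?subr0 ?subrr.
Qed.

End SeriesRing.

Arguments Xn {R} m%_N.
Arguments geom {R} m%_N.
Arguments dilate {R} m%_N f.

(** * Counting overpartitions *)

(** An overlined part may only be a first occurrence, so an overpartition is a
    chain for the relation [above x y]: the part y may come later than x. *)
Definition above (x y : nat * bool) : bool :=
  ((y.1 < x.1) || ((y.1 == x.1) && ~~ y.2))%N.

Lemma above_trans : transitive above.
Proof.
by move=> [b []] [a []] [c []]; rewrite /above /=; lia.
Qed.

(** Whether a part is a first occurrence is a local matter: for the head of a list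
    it always holds, and for a later part it says that the part differs from the
    head and is a first occurrence in the tail. *)
Lemma is_overpartitionE n s : is_overpartition n s =
  [&& sorted above s, (0%N \notin unzip1 s) & sumn (unzip1 s) == n].
Proof.
suff -> : sorted above s = sorted geq (unzip1 s) &&
   all (fun i => nth false (unzip2 s) i ==>
                    (index (nth 0%N (unzip1 s) i) (unzip1 s) == i))
          (iota 0 (size s)).
  by rewrite /is_overpartition; do !case: (X in X && _) => //=; rewrite ?andbF ?andbT.
elim: s => //= x s IHs.
rewrite (path_sortedE above_trans) {}IHs path_sortedE; last first.
  by move=> a b c /= ab bc; apply: leq_trans bc ab.
rewrite eqxx implybT /= -(addn0 1%N) iotaDl all_map /=.
rewrite -!andbA [RHS]andbCA [LHS]andbCA; congr (_ && _).
rewrite all_map.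
pose nth_s := nth (0%N, false) s.
have -> : all (above x) s = all (fun i => above x (nth_s i)) (iota 0 (size s)).
  by rewrite -[in LHS](mkseq_nth (0%N, false) s) all_map.
have -> : all (preim fst (geq x.1)) s =
    all (fun i => (nth_s i).1 <= x.1)%N (iota 0 (size s)).
  by rewrite -[in LHS](mkseq_nth (0%N, false) s) all_map.
rewrite -!all_predI; apply: eq_in_all => i; rewrite mem_iota /= add0n => lt_i.
rewrite (nth_map (0%N, false)) // (nth_map (0%N, false)) // -/(nth_s i).
case: (nth_s i) => a b; rewrite /above /= add1n.
by case: (ltngtP a x.1); case: b.
Qed.

(** The number is an integer z so that it can be compared directly with a
    coefficient of a power series. *)
Definition counted (Q : pred (seq (nat * bool))) (z : int) :=
  exists l, [/\ uniq l, l =i Q & (size l)%:Z = z].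

Lemma pbar_counted n z : counted (is_overpartition n) z -> (pbar n)%:Z = z.
Proof. by case=> l [Ul defl <-]; rewrite (pbar_enum Ul defl). Qed.

Lemma counted0 Q : Q =1 pred0 -> counted Q 0.
Proof. by move=> Q0; exists [::]; split=> // s; rewrite -[RHS]topredE /= Q0. Qed.

Lemma counted_eq Q Q' z : Q =1 Q' -> counted Q z -> counted Q' z.
Proof.
by move=> QQ' [l [Ul defl sl]]; exists l; split=> // s; rewrite defl -!topredE /= QQ'.
Qed.

Lemma countedU (Q Q' : pred (seq (nat * bool))) z z' : (forall s, Q s -> ~~ Q' s) ->
  counted Q z -> counted Q' z' -> counted (predU Q Q') (z + z').
Proof.
move=> dQ [l [Ul defl <-]] [l' [Ul' defl' <-]]; exists (l ++ l'); split.
- rewrite cat_uniq Ul Ul' andbT; apply/hasPn => s; rewrite defl' => Q's /=.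
  by apply: contraL Q's; rewrite defl => /dQ.
- by move=> s; rewrite mem_cat defl defl'.
- by rewrite size_cat PoszD.
Qed.

Definition cons_pred (x : nat * bool) (Q : pred (seq (nat * bool))) :
    pred (seq (nat * bool)) :=
  fun s => if s is y :: t then (y == x) && Q t else false.

Lemma counted_cons x Q z : counted Q z -> counted (cons_pred x Q) z.
Proof.
move=> [l [Ul defl <-]]; exists [seq x :: s | s <- l]; split; rewrite ?size_map //.
  by rewrite map_inj_uniq // => s t [].
move=> [|y s]; first by apply/mapP => -[].
rewrite -topredE /=; apply/mapP/andP => [[t] | [/eqP-> Qs]].
  by rewrite defl => Qt [-> ->].
by exists s; rewrite ?defl.
Qed.

Definition bounded (p : pred (nat * bool)) (n : nat) (s : seq (nat * bool)) :=
  [&& sorted above s, all (fun x => (0 < x.1)%N && p x) s & sumn (unzip1 s) == n].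

(** As y may not follow any element of q, a list that uses y has to start with it;
    the tail then ranges over what may follow y. *)
Lemma bounded_split (p q : pred (nat * bool)) (y : nat * bool) n :
    (0 < y.1)%N -> ~~ q y -> p =1 predU1 y q -> subpred (above y) p ->
    (forall x, q x -> ~~ above x y) ->
  bounded p n =1 predU (bounded q n)
    (cons_pred y (fun t => (y.1 <= n)%N && bounded (above y) (n - y.1) t)).
Proof.
move=> y0 qy pE sub_y no_y [|x s]; first by rewrite /= orbF.
rewrite -[RHS]/(bounded q n (x :: s) ||
  (x == y) && ((y.1 <= n)%N && bounded (above y) (n - y.1) s)).
have [-> | nxy] := eqVneq x y.
  rewrite /bounded /= !(path_sortedE above_trans) -!andbA.
  rewrite (negPf qy) !andbF pE /= eqxx y0 /=.
  have posI (r : pred (nat * bool)) : all (fun x => (0 < x.1)%N && r x) s =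
      all (fun x => 0 < x.1)%N s && all r s by exact: all_predI.
  rewrite !posI.
  case ay: (all (above y) s); last by rewrite !andbF.
  rewrite (sub_all sub_y ay) !andbT andTb.
  rewrite [RHS]andbCA; congr (_ && _); rewrite [RHS]andbCA; congr (_ && _).
  by apply/eqP/andP => [<- | [le_y /eqP ->]]; rewrite ?subnKC // leq_addr addKn.
rewrite orbF /bounded /= !(path_sortedE above_trans) -!andbA pE /= (negPf nxy) /=.
case qx: (q x); rewrite ?andbF //=.
case ax: (all (above x) s) => //=; congr [&& _, _, _ & _].
apply: eq_in_all => z zs; rewrite pE /=; case: eqP => // eq_zy.
by move/allP/(_ z zs): ax; rewrite eq_zy (negPf (no_y x qx)).
Qed.

(** The generating function of overpartitions with parts at most m. *)
Definition overgf m : series int := \prod_(j < m) ((1 + Xn j.+1) * geom j.+1).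

Local Notation upto m := (fun x : nat * bool => (x.1 <= m)%N).

Lemma bounded_upto0 n : bounded (upto 0%N) n =1 if n is 0%N then pred1 [::] else pred0.
Proof.
by case: n => [|n] [|[[|a] b] s] //; rewrite /bounded /= ?andbF.
Qed.

(** The overpartitions that may follow m+1 may start with a plain m+1, after which
    they are of the same kind: their series g satisfies g = f + q^(m+1) g. The
    flag b serves to state this both for a plain m+1, as in the recursion, and for
    an overlined one, as in [counted_upto]. *)
Lemma counted_flagged m (f : series int) :
    (forall n, counted (bounded (upto m) n) (f n)) ->
  forall n b, counted (bounded (above (m.+1, b)) n) ((f * geom m.+1) n).
Proof.
move=> cf n b; have [k le_nk] := ubnP n; elim: k => // k IHk in n le_nk *.
set g := f * _ in IHk *.
have -> : g n = f n + (Xn m.+1 * g) n.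
  rewrite -seriesDE; congr coef_series.
  suff -> : f = g * (1 - Xn m.+1) by ring.
  by rewrite /g -mulrA [_ * (1 - _)]mulrC geomK mulr1.
have c2 : counted (fun t => (m.+1 <= n)%N && bounded (above (m.+1, false)) (n - m.+1) t)
    ((Xn m.+1 * g) n).
  rewrite seriesXnM; case: ifP => [le_mn | _]; last exact: counted0.
  by apply: (IHk (n - m.+1)%N); lia.
apply: (counted_eq _ (countedU _ (cf n) (counted_cons (m.+1, false) c2))) => s.
  by apply/esym/bounded_split => //=; try move=> [x []];
    rewrite /above /= ?xpair_eqE; lia.
case: s => // x s; rewrite /bounded /= => /and3P[_ /andP[/andP[_ x_le] _] _].
by apply/nandP; left; apply: contraTneq x_le => -> /=; rewrite ltnn.
Qed.

(** An overlined m+1 can only come first, and what follows it is counted by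
    [counted_flagged]; this is the factor 1 + q^(m+1). *)
Lemma counted_upto m n : counted (bounded (upto m) n) (overgf m n).
Proof.
elim: m n => [|m IHm] n.
  apply: counted_eq (fun s => esym (bounded_upto0 n s)) _.
  rewrite /overgf big_ord0; case: n => [|n]; last exact: counted0.
  by exists [:: [::]]; split=> // s; rewrite inE.
have cg := counted_flagged IHm; set g := overgf m * _ in cg.
have -> : overgf m.+1 n = g n + (Xn m.+1 * g) n.
  by rewrite -seriesDE; congr coef_series; rewrite /g /overgf big_ord_recr /=; ring.
have c2 : counted (fun t => (m.+1 <= n)%N && bounded (above (m.+1, true)) (n - m.+1) t)
    ((Xn m.+1 * g) n).
  by rewrite seriesXnM; case: ifP => [le_mn | _]; [apply: cg | apply: counted0].
apply: (counted_eq _ (countedU _ (cg n true) (counted_cons (m.+1, true) c2))) => s.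
  by apply/esym/bounded_split => //=; try move=> [x []];
    rewrite /above /= ?xpair_eqE; lia.
case: s => // x s; rewrite /bounded /= => /and3P[_ /andP[/andP[_ x_le] _] _].
by apply/nandP; left; apply: contraTneq x_le => -> /=; rewrite /above ltnn eqxx.
Qed.

Lemma pbar_overgf m n : (n <= m)%N -> (pbar n)%:Z = overgf m n.
Proof.
move=> le_nm; apply/pbar_counted/(counted_eq _ (counted_upto m n)) => s.
apply/idP/idP => [/and3P[sorted_s s_ok sum_s] | ov].
  rewrite is_overpartitionE sorted_s sum_s andbT /=.
  by apply/mapP => -[x /(allP s_ok)/andP[x0 _] Dx]; rewrite -Dx in x0.
have [_ le_s] := is_overpartition_bound ov.
move: ov; rewrite is_overpartitionE => /and3P[sorted_s s0 sum_s].
rewrite /bounded sorted_s sum_s andbT; apply/allP => x xs.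
rewrite lt0n (leq_trans (le_s x xs) le_nm) andbT.
by apply: contraNneq s0 => <-; apply: map_f.
Qed.

(** * Gauss's identity *)

(** The q-Pochhammer products (q;q)_n, its inverse, and (-q;q)_n. *)
Definition qfact n : series int := \prod_(j < n) (1 - Xn j.+1).
Definition iqfact n : series int := \prod_(j < n) geom j.+1.
Definition pqfact n : series int := \prod_(j < n) (1 + Xn j.+1).

Lemma qfactS n : qfact n.+1 = qfact n * (1 - Xn n.+1).
Proof. exact: big_ord_recr. Qed.
Lemma pqfactS n : pqfact n.+1 = pqfact n * (1 + Xn n.+1).
Proof. exact: big_ord_recr. Qed.

Lemma iqfactS n : iqfact n.+1 * (1 - Xn n.+1) = iqfact n.
Proof. by rewrite /iqfact big_ord_recr /= -mulrA [geom _ * _]mulrC geomK mulr1. Qed.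

Lemma qfactK n : qfact n * iqfact n = 1.
Proof.
elim: n => [|n IHn]; first by rewrite /qfact /iqfact !big_ord0 mulr1.
by rewrite qfactS -mulrA [(1 - _) * _]mulrC iqfactS.
Qed.

Lemma overgfE n : overgf n = pqfact n * iqfact n.
Proof. exact: big_split. Qed.

(** For K = n this is the sum over all integers k of
    (-1)^k q^(k^2) / ((q;q)_(n-k) (q;q)_(n+k)), folded by the symmetry k <-> -k.
    Multiplied by (q;q)_n^2 it tends to phi(-q); stopping at an arbitrary K makes
    the recurrence in n provable by telescoping. *)
Definition gauss_sum n K : series int :=
  iqfact n ^+ 2 + 2 * \sum_(k < K)
    (-1) ^+ k.+1 * (Xn (k.+1 ^ 2)%N * iqfact (n - k.+1) * iqfact (n + k.+1)).

Lemma gauss_sumS n K : gauss_sum n K.+1 = gauss_sum n K +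
  2 * ((-1) ^+ K.+1 * (Xn (K.+1 ^ 2)%N * iqfact (n - K.+1) * iqfact (n + K.+1))).
Proof. by rewrite /gauss_sum big_ord_recr /= mulrDr addrA. Qed.

(** With x = q^(n-k+1) and y = q^(n+k+1), the equality
    1 - xy = (1 - x)(1 - y) + x(1 - y) + y(1 - x) writes 1 - q^(2n+2) times the
    k-th term at n+1 as the k-th term at n, plus two terms which cancel against
    the neighbouring values of k. The last summand is the one left over. *)
Lemma gauss_sum_partial n K : (K <= n)%N ->
  (1 - Xn n.+1.*2) * gauss_sum n.+1 K = gauss_sum n K +
    2 * ((-1) ^+ K * (Xn (K ^ 2 + K + n.+1)%N * iqfact (n - K) * iqfact (n + K).+1)).
Proof.
elim: K => [|K IHK] le_Kn.
  rewrite /gauss_sum !big_ord0 subn0 !addn0 exp0n // add0n -(iqfactS n) -addnn XnD.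
  by rewrite expr0; ring.
rewrite gauss_sumS mulrDr (IHK (ltnW le_Kn)) gauss_sumS.
have [d Dn] : exists d, (n = d + K.+1)%N by exists (n - K.+1)%N; lia.
rewrite (_ : n.+1 - K.+1 = d.+1)%N; last lia.
rewrite (_ : n - K = d.+1)%N; last lia.
rewrite (_ : n - K.+1 = d)%N; last lia.
rewrite (_ : n.+1 + K.+1 = (n + K.+1).+1)%N; last lia.
rewrite (_ : (n + K).+1 = n + K.+1)%N; last lia.
rewrite (_ : n.+1.*2 = d.+1 + (n + K.+1).+1)%N; last lia.
rewrite (_ : K ^ 2 + K + n.+1 = K.+1 ^ 2 + d.+1)%N; last lia.
rewrite (_ : K.+1 ^ 2 + K.+1 + n.+1 = K.+1 ^ 2 + (n + K.+1).+1)%N; last lia.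
rewrite -(iqfactS d) -(iqfactS (n + K.+1)) !XnD [(-1) ^+ K.+1]exprS.
by ring.
Qed.

(** The extra term k = n+1 at n+1 cancels the remainder of [gauss_sum_partial]. *)
Lemma gauss_sum_rec n :
  (1 - Xn n.+1.*2) * gauss_sum n.+1 n.+1 = gauss_sum n n.
Proof.
rewrite gauss_sumS mulrDr gauss_sum_partial // !subnn.
rewrite (_ : n.+1.*2 = (n + n).+2)%N; last lia.
rewrite (_ : n.+1 + n.+1 = (n + n).+2)%N; last lia.
rewrite (_ : n ^ 2 + n + n.+1 = n.+1 ^ 2)%N; last lia.
by rewrite -(iqfactS (n + n).+1) exprS; ring.
Qed.

Lemma gauss_sumK n : gauss_sum n n * qfact n * pqfact n = 1.
Proof.
elim: n => [|n IHn].
  by rewrite /gauss_sum /iqfact /qfact /pqfact !big_ord0 mulr0 addr0 !mulr1 expr1n.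
rewrite -[RHS]IHn -(gauss_sum_rec n) qfactS pqfactS -addnn XnD.
by ring.
Qed.

Lemma qfact_eqmodX m n : (m <= n)%N -> eqmodX m.+1 (qfact n) (qfact m).
Proof.
elim: n => [|n IHn]; first by rewrite leqn0 => /eqP->.
rewrite leq_eqVlt => /predU1P[-> | lt_mn]; first exact: eqmodX_refl.
apply: eqmodX_trans (IHn lt_mn); rewrite qfactS mulrBr mulr1 -[X in eqmodX _ _ X]addr0.
apply: eqmodXD => //; move=> i lt_im; rewrite mulrC.
rewrite seriesNE (eqmodX_Xn0 (N := m.+1)) ?oppr0 //.
Qed.

Lemma qfact_iqfact m n k : (k <= m)%N -> (k <= n)%N -> eqmodX k.+1 (qfact m * iqfact n) 1.
Proof.
move=> le_km le_kn; rewrite -(qfactK n); apply: eqmodXM => //.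
apply: eqmodX_trans (qfact_eqmodX le_km) _; apply: eqmodX_sym; exact: qfact_eqmodX.
Qed.

Definition square n := [exists k : 'I_n.+1, (k ^ 2 == n)%N].

Lemma squareP n : reflect (exists k, n = k ^ 2)%N (square n).
Proof.
apply: (iffP existsP) => [[k /eqP <-] | [k ->]]; first by exists k.
have lt_k : (k < (k ^ 2).+1)%N by rewrite -mulnn; nia.
by exists (Ordinal lt_k) => /=.
Qed.

(** Half of the nonconstant part of phi. *)
Definition sqs : series int := Series (fun n => ((0 < n)%N && square n)%:R).
Definition phi : series int := 1 + 2 * sqs.

Lemma series_sumE (I : Type) (r : seq I) (P : pred I) (F : I -> series int) n :
  (\sum_(i <- r | P i) F i) n = \sum_(i <- r | P i) F i n.
Proof. by elim/big_rec2: _ => // i _ y _ <-. Qed.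

Lemma sqs_eqmodX N : eqmodX N.+1 (\sum_(k < N) Xn (k.+1 ^ 2)%N) sqs.
Proof.
move=> n lt_nN; rewrite series_sumE /=.
case: (boolP (_ && _)) => [/andP[n0 /squareP[[|k] Dn]] | nsq]; first by rewrite Dn in n0.
  have lt_kN : (k < N)%N by move: lt_nN; rewrite Dn -mulnn; nia.
  rewrite (bigD1 (Ordinal lt_kN)) //= -Dn eqxx big1 // => i ne_i.
  case: eqP => // Di; case/eqP: ne_i; apply: val_inj => /=.
  by move: Di; rewrite Dn => /eqP; rewrite eqn_exp2r // => /eqP[].
rewrite big1 // => i _; case: eqP => // Dn; case/negP: nsq.
by rewrite Dn expn_gt0; apply/squareP; exists i.+1.
Qed.

(** The quotients (q;q)_n/(q;q)_(n-k) and (q;q)_n/(q;q)_(n+k) are 1 modulo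
    q^(n-k+1), and the factor q^(k^2) makes up for the missing precision, because
    k^2 >= k. *)
Lemma gauss_sum_twist_phi n : eqmodX n.+1 (qfact n ^+ 2 * gauss_sum n n) (twist phi).
Proof.
rewrite /phi rmorphD rmorphM rmorph1 rmorph_nat /gauss_sum mulrDr.
apply: eqmodXD; first by rewrite -exprMn qfactK expr1n.
rewrite mulrCA; apply: eqmodXM => //.
apply: (@eqmodX_trans _ _ _ (twist (\sum_(k < n) Xn (k.+1 ^ 2)%N))); last first.
  by move=> i lt_in; rewrite !twistE sqs_eqmodX.
rewrite raddf_sum mulr_sumr /= => i lt_in; rewrite !series_sumE.
apply: eq_bigr => k _; have lt_kn := ltn_ord k.
rewrite twist_Xn -[in RHS]signr_odd oddX orFb signr_odd.
rewrite mulrCA; apply: eqmodXM i lt_in => //.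
set x := Xn _; set b := iqfact (n - _); set c := iqfact (n + _).
have -> : qfact n ^+ 2 * (x * b * c) = x * ((qfact n * b) * (qfact n * c)) by ring.
rewrite -[X in eqmodX _ _ X]mulr1; apply: eqmodX_XnM.
apply: (@eqmodX_le _ _ (n - k.+1).+1); first lia.
rewrite -[X in eqmodX _ _ X]mulr1; apply: eqmodXM; apply: qfact_iqfact; lia.
Qed.

Definition pbar_series : series int := Series (fun n => (pbar n)%:Z).
Local Notation P := pbar_series.

Lemma pbar_eqmodX m n : (n <= m)%N -> eqmodX n.+1 P (overgf m).
Proof. by move=> le_nm i lt_in; apply: pbar_overgf; lia. Qed.

Lemma twist_phiP : twist phi * P = 1.
Proof.
apply: eqmodX_eq => n; apply: (@eqmodX_le _ _ n.+1) => //.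
have -> : 1 = qfact n ^+ 2 * gauss_sum n n * overgf n.
  rewrite -[LHS](gauss_sumK n) -[in LHS](mulr1 (pqfact n)) -(qfactK n) overgfE.
  by ring.
apply: eqmodXM; first exact/eqmodX_sym/gauss_sum_twist_phi.
exact: pbar_eqmodX.
Qed.

(** * Dissection of the theta series *)

(** The odd factors (1 + q^m)/(1 - q^m) and (1 - q^m)/(1 + q^m) cancel, and the
    even ones give the square. *)
Lemma overgf_twist n :
  overgf n.*2 * twist (overgf n.*2) = dilate 2 (overgf n) ^+ 2.
Proof.
elim: n => [|n IHn]; first by rewrite /overgf !big_ord0 !rmorph1 mulr1 expr1n.
have oS m : overgf m.+1 = overgf m * ((1 + Xn m.+1) * geom m.+1).
  exact: big_ord_recr.
rewrite doubleS !oS !rmorphM !rmorphD !rmorph1 /= dilate_Xn !twist_Xn.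
have -> : dilate 2 (geom n.+1) = geom n.*2.+2 :> series int.
  by rewrite /geom dilate_dilate // mul2n doubleS.
have -> : twist (geom n.*2.+2) = geom n.*2.+2 :> series int.
  by rewrite twist_dilate //= odd_double.
rewrite -[(-1 : series int) ^+ _.+1]signr_odd -[(-1 : series int) ^+ _.+2]signr_odd.
rewrite /= odd_double /=.
rewrite (_ : 2 * n.+1 = n.*2.+2)%N; last lia.
set x := Xn n.*2.+1; set y := Xn n.*2.+2.
set g := geom _.+1; set g' := twist g; set gy := geom _.+2.
have gK : (1 - x) * g = 1 by exact: geomK.
have gK' : (1 + x) * g' = 1.
  have -> : 1 + x = twist (1 - x).
    rewrite rmorphB rmorph1 /= twist_Xn -[(-1 : series int) ^+ _]signr_odd.
    by rewrite /= odd_double expr1 mulN1r opprK.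
  by rewrite -rmorphM gK rmorph1.
transitivity ((overgf n.*2 * twist (overgf n.*2)) *
  (((1 - x) * g) * ((1 + x) * g')) * ((1 + y) * gy) ^+ 2).
  by rewrite expr0 expr1; ring.
by rewrite IHn gK gK'; ring.
Qed.

Lemma P_twist : P * twist P = dilate 2 P ^+ 2.
Proof.
apply: eqmodX_eq => n; apply: (@eqmodX_le _ _ n.+1) => //.
apply: (@eqmodX_trans _ _ _ (overgf n.*2 * twist (overgf n.*2))).
  have PE : eqmodX n.+1 P (overgf n.*2) by apply: pbar_eqmodX; lia.
  by apply: eqmodXM => // i lt_in; rewrite !twistE PE.
rewrite overgf_twist !expr2.
have dE : eqmodX n.+1 (dilate 2 (overgf n)) (dilate 2 P).
  move=> i lt_in; rewrite !dilateE; case: ifP => // _.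
  by rewrite (pbar_eqmodX (leqnn n)) //; lia.
exact: eqmodXM.
Qed.

(** The number 8n+1 is a square exactly when n is triangular. *)
Definition psi : series int := Series (fun n => (square (8 * n + 1))%:R).

Lemma odd_sqr_mod8 k : odd k -> exists j, (k ^ 2 = 8 * j + 1)%N.
Proof.
move=> odd_k; set m := k./2; exists (m * m.+1)./2.
have := odd_double_half (m * m.+1); rewrite oddM oddS andbN add0n => Dm.
by rewrite -[k]odd_double_half odd_k -/m -mulnn; move: Dm; nia.
Qed.

Lemma square_4muln m : square (4 * m) = square m.
Proof.
apply/squareP/squareP => [[k Dk] | [k ->]]; last by exists (2 * k)%N; rewrite expnMn.
have ev_k : ~~ odd k by rewrite -[odd k]/(false || odd k) -(oddX k 2) -Dk oddM.
exists k./2; apply/eqP; rewrite -(eqn_pmul2l (m := 4)) // Dk.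
by rewrite -[k in (k ^ 2)%N]even_halfK // -muln2 expnMn mulnC.
Qed.

Lemma sqs_split : sqs = dilate 4 sqs + Xn 1 * dilate 8 psi.
Proof.
apply: seriesP => n; rewrite seriesDE seriesXnM !dilateE /=.
have [/dvdnP[m ->] | n4] := boolP (4 %| n)%N.
  rewrite mulnK // [(m * 4)%N]mulnC square_4muln muln_gt0 /=.
  case: ifP => [m0|]; last by rewrite addr0.
  by case: ifP => [|_]; [lia | rewrite addr0].
rewrite add0r; case: n n4 => // n n4; rewrite subn1 /=.
case: ifP => [/dvdnP[j ->] | n8]; first by rewrite mulnK // mulnC addn1.
case: squareP => // -[k Dk]; have [odd_k | ev_k] := boolP (odd k).
  by have [j] := odd_sqr_mod8 odd_k; lia.
move: n4; rewrite Dk -[k]even_halfK // -muln2 expnMn.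
by rewrite dvdn_mull.
Qed.

(** The sum of q^(k^2) over odd k > 0; a notation, so that morphisms can be pushed
    into its factors. *)
Local Notation qpsi8 := (Xn 1 * dilate 8 psi).

Lemma phi_split : phi = dilate 4 phi + 2 * qpsi8.
Proof.
rewrite {1}/phi {1}sqs_split /phi rmorphD rmorphM rmorph1 rmorph_nat /=.
by ring.
Qed.

Lemma twist_qpsi8 : twist qpsi8 = - qpsi8.
Proof. by rewrite rmorphM /= twist_Xn twist_dilate // expr1 mulN1r mulNr. Qed.

Lemma twist_phi : twist phi = dilate 4 phi - 2 * qpsi8.
Proof.
by rewrite {1}phi_split rmorphD rmorphM rmorph_nat /= twist_qpsi8 twist_dilate // mulrN.
Qed.

Lemma phi_twistP : phi * twist P = 1.
Proof. by rewrite -{1}(twistK phi) -rmorphM twist_phiP rmorph1. Qed.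

(** This is [P_twist] read for the inverses of its terms. *)
Lemma phi_mul_twist : phi * twist phi = dilate 2 (twist phi) ^+ 2.
Proof.
have E : (phi * twist phi) * dilate 2 P ^+ 2 = 1.
  rewrite -P_twist; transitivity ((phi * twist P) * (twist phi * P)); first by ring.
  by rewrite phi_twistP twist_phiP mulr1.
have E' : dilate 2 (twist phi) * dilate 2 P = 1 by rewrite -rmorphM twist_phiP rmorph1.
rewrite -[LHS]mulr1 -(expr1n _ 2) -E' exprMn mulrCA E mulr1 //.
Qed.

(** After q -> q^2 and a change of sign, this is phi(q)phi(-q) = phi(-q^2)^2 with
    the left-hand side expanded as (a + 2b)(a - 2b). *)
Lemma phi_sqr : phi ^+ 2 = dilate 2 phi ^+ 2 + 4 * (Xn 1 * dilate 4 psi ^+ 2).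
Proof.
suff E : twist phi ^+ 2 = dilate 2 phi ^+ 2 - 4 * (Xn 1 * dilate 4 psi ^+ 2).
  rewrite -[LHS]twistK rmorphXn /= E rmorphB !rmorphM ?rmorphXn rmorph_nat /=.
  by rewrite twist_Xn !twist_dilate // expr1; ring.
apply: (@dilate_inj _ 1); rewrite rmorphXn /= -phi_mul_twist phi_split.
rewrite rmorphB !rmorphM ?rmorphXn /= rmorph_nat dilate_Xn !dilate_dilate //.
rewrite -phi_split twist_phi {1}phi_split.
rewrite (_ : (2 * 1 = 1 + 1)%N) // XnD.
by ring.
Qed.

Lemma dilate2_phi_sqr : dilate 2 phi ^+ 2 = dilate 4 phi ^+ 2 + 4 * qpsi8 ^+ 2.
Proof.
rewrite -rmorphXn phi_sqr rmorphD !rmorphM ?rmorphXn /= rmorph_nat dilate_Xn.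
rewrite !dilate_dilate //.
by rewrite (_ : (2 * 1 = 1 + 1)%N) // XnD; ring.
Qed.

(** The relation P(q) = phi(q) P(q^2)^2, used twice. *)
Lemma P_factor : P = phi * (dilate 4 phi ^+ 2 + 4 * qpsi8 ^+ 2) * dilate 4 P ^+ 4.
Proof.
have step : P = phi * dilate 2 P ^+ 2.
  by rewrite -P_twist mulrCA phi_twistP mulr1.
rewrite {1}step {1}step rmorphM rmorphXn /= dilate_dilate // exprMn -exprM.
by rewrite dilate2_phi_sqr mulrA.
Qed.

Lemma XnM_dilate_eq0 r m (f : series int) n :
  n != r %[mod m] -> (Xn r * dilate m f) n = 0.
Proof.
move=> ne_nr; rewrite seriesXnM dilateE; case: ifP => // le_r.
by case: ifP => // m_dv; rewrite eqn_mod_dvd ?m_dv in ne_nr.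
Qed.

(** * The congruences *)

(** The three other terms in the expansion of (a + 2b)(a^2 + 4b^2) have their
    exponents in the classes 1, 2 and 3 modulo 4. *)
Lemma P_4muln n : P (4 * n)%N = (phi ^+ 3 * P ^+ 4) n.
Proof.
pose c := dilate 2 psi.
have dc : dilate 8 psi = dilate 4 c by rewrite dilate_dilate.
have PE : P = dilate 4 (phi ^+ 3 * P ^+ 4)
   + (Xn 1 * dilate 4 (2 * phi ^+ 2 * c * P ^+ 4)
   + Xn 2 * dilate 4 (4 * phi * c ^+ 2 * P ^+ 4)
   + Xn 3 * dilate 4 (8 * c ^+ 3 * P ^+ 4)).
  have X2 : Xn 2 = Xn 1 * Xn 1 :> series int by rewrite -XnD.
  have X3 : Xn 3 = Xn 1 * Xn 2 :> series int by rewrite -XnD.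
  rewrite {1}P_factor {1}phi_split dc !(rmorphXn, rmorphM, rmorph_nat) /= X3 X2.
  by ring.
by rewrite {1}PE !seriesDE dilate_muln !XnM_dilate_eq0 ?modnMr // !addr0.
Qed.

(** Writing p = 1/(a - 2b) and p' = 1/(a + 2b), the difference is
    16 a b (a^2 + 4b^2) p' p^4, and a^2 + 4b^2 = (a + 2b)(a - 2b) + 8b^2. *)
Lemma theta_quotient_mod128 : exists E : series int, phi ^+ 3 * P ^+ 4 - twist P =
   16 * (dilate 4 phi ^+ 2 * qpsi8 - 2 * (dilate 4 phi * qpsi8 ^+ 2)) + 128 * E.
Proof.
pose a := dilate 4 phi; pose b : series int := qpsi8.
pose p := P; pose p' := twist P.
have phiE : phi = a + 2 * b by exact: phi_split.
have G : (a - 2 * b) * p = 1 by rewrite -twist_phi twist_phiP.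
have G' : (a + 2 * b) * p' = 1 by rewrite -phiE phi_twistP.
rewrite -/a -/b -/p -/p' phiE.
have [y Dp] : exists y, p = 1 + 2 * y.
  pose z := dilate 4 sqs - b; exists (- z * p).
  have Dz : a - 2 * b = 1 + 2 * z.
    by rewrite /a /phi rmorphD rmorphM rmorph1 rmorph_nat /z /=; ring.
  transitivity ((1 + 2 * z) * p - 2 * (z * p)); first by ring.
  by rewrite -Dz G; ring.
(* A fourth power of an odd series is 1 modulo 8. *)
have [w Dw] : exists w, p ^+ 4 = 1 + 8 * w.
  by exists (y + 3 * y ^+ 2 + 4 * y ^+ 3 + 2 * y ^+ 4); rewrite Dp; ring.
exists (a * b * (a - 2 * b) * w + a * b ^+ 3 * p' * p ^+ 4).
have -> : (a + 2 * b) ^+ 3 * p ^+ 4 - p' =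
  16 * (a * b * (a - 2 * b) * ((a + 2 * b) * p') * p ^+ 4 +
        8 * (a * b ^+ 3 * p' * p ^+ 4)).
  (* Both terms are brought over the common denominator phi(q) phi(-q)^4. *)
  transitivity ((a + 2 * b) ^+ 3 * ((a + 2 * b) * p') * p ^+ 4 -
    p' * ((a - 2 * b) * p) ^+ 4).
    by rewrite G G'; ring.
  by ring.
by rewrite G' {1}Dw; ring.
Qed.

Lemma series_natrM k (f : series int) n : (k%:R * f) n = k%:R * f n.
Proof. by rewrite !mulr_natl seriesMnE. Qed.

Lemma pbar_4muln_mod128 n : exists e : int, (pbar (4 * n))%:Z = (-1) ^+ n * (pbar n)%:Z +
  16 * ((dilate 4 phi ^+ 2 * qpsi8) n - 2 * (dilate 4 phi * qpsi8 ^+ 2) n) + 128 * e.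
Proof.
have [E diffE] := theta_quotient_mod128; exists (E n).
have := congr1 (fun f : series int => coef_series f n) diffE.
rewrite !seriesDE !series_natrM !seriesDE !seriesNE series_natrM -P_4muln twistE => H.
by apply/eqP; rewrite -addrA addrC -subr_eq; apply/eqP/(etrans H).
Qed.

Lemma pbar_4muln_mod64 n : exists e : int, (pbar (4 * n))%:Z = (-1) ^+ n * (pbar n)%:Z +
  16 * (qpsi8 n - 2 * (qpsi8 ^+ 2) n) + 64 * e.
Proof.
have [e ->] := pbar_4muln_mod128 n.
pose s := dilate 4 sqs; have aE : dilate 4 phi = 1 + 2 * s.
  by rewrite rmorphD rmorphM rmorph1 rmorph_nat.
set b : series int := qpsi8.
have -> : dilate 4 phi ^+ 2 * b = b + 4 * ((s + s ^+ 2) * b) by rewrite aE; ring.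
have -> : dilate 4 phi * b ^+ 2 = b ^+ 2 + 2 * (s * b ^+ 2) by rewrite aE; ring.
rewrite !seriesDE !series_natrM; exists (((s + s ^+ 2) * b) n - (s * b ^+ 2) n + 2 * e).
by ring.
Qed.

Lemma eqz_modP (d x y k : int) : x = y + d * k -> (x = y %[mod d])%Z.
Proof. by move=> ->; rewrite addrC mulrC modzMDl. Qed.

Close Scope ring_scope.

Theorem theorem1p3 (n : nat) :
  [/\ ((pbar (4 * n))%:Z = (-1) ^+ n * (pbar n)%:Z %[mod 16])%Z,
      (~ exists m : nat, odd m /\ n = m ^ 2) ->
        ((pbar (4 * n))%:Z = (-1) ^+ n * (pbar n)%:Z %[mod 32])%Z,
      ~ (n = 1 %[mod 8] \/ n = 2 %[mod 8] \/ n = 5 %[mod 8]) ->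
        ((pbar (4 * n))%:Z = (-1) ^+ n * (pbar n)%:Z %[mod 64])%Z
    & n = 0 %[mod 4] ->
        ((pbar (4 * n))%:Z = (-1) ^+ n * (pbar n)%:Z %[mod 128])%Z].
Proof.
set x := ((pbar (4 * n))%:Z)%R; set y := ((-1) ^+ n * (pbar n)%:Z)%R.
have [e] := pbar_4muln_mod128 n; have [f] := pbar_4muln_mod64 n.
rewrite -/x -/y.
set b := coef_series qpsi8 n; set b2 := coef_series (qpsi8 ^+ 2)%R n.
set a2b := coef_series (_ * qpsi8)%R n; set ab2 := coef_series (_ * qpsi8 ^+ 2)%R n.
move=> mod64 mod128; split.
- by apply: (eqz_modP (k := (a2b - 2 * ab2 + 8 * e)%R)); rewrite mod128; ring.
- move=> n_nsq; have b0 : b = 0%R.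
    rewrite /b seriesXnM; case: ifP => // n_gt0; rewrite dilateE; case: ifP => // n8.
    suff /negPf nsq : ~~ square (8 * ((n - 1) %/ 8) + 1) by rewrite /= nsq.
    apply/squareP => -[m Dm]; case: n_nsq.
    have Dn : n = m ^ 2 by rewrite -Dm mulnC divnK // subnK.
    exists m; split=> //; move: Dm (congr1 odd Dm); rewrite oddX oddD oddM /=; lia.
  by apply: (eqz_modP (k := (2 * f - b2)%R)); rewrite mod64 b0; ring.
- move=> n_mod8; have b0 : b = 0%R.
    by apply: XnM_dilate_eq0; apply/eqP => n1; apply: n_mod8; left.
  have b20 : b2 = 0%R.
    rewrite /b2 exprMn -[(Xn 1 ^+ 2)%R]XnD -rmorphXn.
    by apply: XnM_dilate_eq0; apply/eqP => n2; apply: n_mod8; right; left.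
  by apply: (eqz_modP (k := f)); rewrite mod64 b0 b20; ring.
- move=> n_mod4; pose c : series int := dilate 2 psi.
  have dc : dilate 8 psi = dilate 4 c by rewrite dilate_dilate.
  have a2b0 : a2b = 0%R.
    rewrite /a2b dc mulrCA -rmorphXn -rmorphM.
    by apply: XnM_dilate_eq0; rewrite n_mod4.
  have ab20 : ab2 = 0%R.
    rewrite /ab2 dc exprMn -[(Xn 1 ^+ 2)%R]XnD mulrCA -rmorphXn -rmorphM.
    by apply: XnM_dilate_eq0; rewrite n_mod4.
  by apply: (eqz_modP (k := e)); rewrite mod128 a2b0 ab20; ring.
Qed.
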